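(* Let $p\in(0,1]$ and $C\in\mathbb{R}$. For the single-user Markov decision process with arrival probability $p$ and updating cost $C$ (described in the context), there exists a stationary and deterministic policy that is cost-optimal, independently of the initial state $\mathbf{s}(0)$ (i.e. a single stationary deterministic policy minimizes the average cost, over all policies, for every initial state).
   Context: Single-user Markov decision process (MDP), in discrete time $t=0,1,2,\dots$. States: $\mathbf{s}(t)=(X(t),\Lambda(t))$ with age $X(t)\in\{1,2,\dots\}$ and arrival indicator $\Lambda(t)\in\{0,1\}$. Actions: $a(t)\in\{0,1\}$, where $1$ means ''update'' and $0$ means ''idle''; both actions are available in every state. Transitions: from state $(x,\lambda)$ under action $a$, the next age is $1$ if $a=\lambda=1$ and is $x+1$ otherwise; independently of the past, the next arrival indicator is $1$ with probability $p$ and $0$ with probability $1-p$. Immediate cost: $C\bigl((x,\lambda),a\bigr)=(x+1-x\,a\,\lambda)+C\,a$, where the real number $C$ is the updating cost. Policies: a policy $\mu=\{a(0),a(1),\dots\}$ specifies an action for each slot. It may be history dependent (the action $a(t)$ may depend on $\mathbf{s}(0),\dots,\mathbf{s}(t)$ and $a(0),\dots,a(t-1)$) and randomized (an action is chosen with a probability). A policy is stationary if $a(t_1)=a(t_2)$ whenever $\mathbf{s}(t_1)=\mathbf{s}(t_2)$, and deterministic if it chooses actions with certainty; thus a stationary deterministic policy is a function from states to actions. Average cost of a policy $\mu$: $\limsup_{T\to\infty}\frac{1}{T+1}E_\mu\left[\sum_{t=0}^{T}C(\mathbf{s}(t),a(t))\right]$, where $E_\mu$ is the expectation when $\mu$ is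 employed. A policy (possibly history dependent) is cost-optimal if it minimizes the average cost among all policies. *)

(* Defs.v *)
From HB Require Import structures.
From mathcomp Require Import all_boot all_order all_algebra.
From mathcomp Require Import all_classical all_reals all_analysis.

Set Implicit Arguments.
Unset Strict Implicit.
Unset Printing Implicit Defensive.

Import Order.TTheory GRing.Theory Num.Theory.
Local Open Scope ring_scope.

Definition age := {x : nat | (0 < x)%N}.
Definition state := (age * bool)%type.
(* [true] is "update", [false] is "idle". *)
Definition action := bool.

Definition next_age (x : age) (lam : bool) (a : action) : age :=
  if a && lam then exist _ 1%N isT else exist _ (sval x).+1 isT.

(* [lam'] is the next arrival indicator. *)
Definition next_state (s : state) (a : action) (lam' : bool) : state :=
  (next_age s.1 s.2 a, lam').

Definition cost {R : realType} (C : R) (s : state) (a : action) : R :=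
  let x := sval s.1 in
  (x%:R + 1 - x%:R * a%:R * s.2%:R) + C * a%:R.

(* The past [:: (s(0), a(0)); ...; (s(t-1), a(t-1))] at time t, in
   chronological order; the current state s(t) is kept separately. *)
Definition history := seq (state * action).

(* [update_prob h s] is the conditional probability of updating at time
   [size h], given the past [h] and the current state [s]. *)
Record policy (R : realType) := Policy {
  update_prob :> history -> state -> R;
  update_prob_itv : forall h s, 0 <= update_prob h s <= 1 }.

Definition stationary {R : realType} (mu : policy R) : Prop :=
  forall h1 h2 s, mu h1 s = mu h2 s.

Definition deterministic {R : realType} (mu : policy R) : Prop :=
  forall h s, mu h s = 0 \/ mu h s = 1.

(* The randomness of a trajectory started from s(0) is the sequence
   w = [:: (a(0), Lambda(1)); (a(1), Lambda(2)); ...] of actions and next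
   arrival indicators; [run s0 w] is the past and the current state at time
   [size w] along w. *)
Definition run (s0 : state) (w : seq (action * bool)) : history * state :=
  foldl (fun hs al => (rcons hs.1 (hs.2, al.1), next_state hs.2 al.1 al.2))
        ([::], s0) w.

(* [bernoulli_pmf q b] is q if b is true and 1 - q otherwise. *)
Definition path_prob {R : realType} (p : R) (mu : policy R) (s0 : state)
    (T : nat) (w : T.-tuple (action * bool)) : R :=
  \prod_(t < T)
    let hs := run s0 (take t w) in
    bernoulli_pmf (mu hs.1 hs.2) (tnth w t).1 * bernoulli_pmf p (tnth w t).2.

Definition path_cost {R : realType} (C : R) (s0 : state)
    (T : nat) (w : T.-tuple (action * bool)) : R :=
  \sum_(t < T) cost C (run s0 (take t w)).2 (tnth w t).1.

(* E_mu of the sum of the costs of the T slots 0, ..., T - 1: the law of the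
   first T slots has finite support. *)
Definition expected_cost {R : realType} (p C : R) (mu : policy R) (s0 : state)
    (T : nat) : R :=
  \sum_(w : T.-tuple (action * bool)) path_prob p mu s0 w * path_cost C s0 w.

Definition average_cost {R : realType} (p C : R) (mu : policy R) (s0 : state)
    : \bar R :=
  limn_esup (fun T : nat => (T.+1%:R^-1 * expected_cost p C mu s0 T.+1)%:E).

Definition cost_optimal {R : realType} (p C : R) (s0 : state) (mu : policy R)
    : Prop :=
  forall nu : policy R,
    (average_cost p C mu s0 <= average_cost p C nu s0)%E.

Lemma path_prob_ge0 {R : realType} (p : R) (mu : policy R) (s0 : state)
    (T : nat) (w : T.-tuple (action * bool)) :
  0 <= p <= 1 -> 0 <= path_prob p mu s0 w.
Proof.
move=> p01; apply: prodr_ge0 => t _ /=.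
by rewrite mulr_ge0 // bernoulli_pmf_ge0 // update_prob_itv.
Qed.

Lemma sum_path_prob {R : realType} (p : R) (mu : policy R) (s0 : state)
    (T : nat) :
  \sum_(w : T.-tuple (action * bool)) path_prob p mu s0 w = 1.
Proof.
elim: T => [|T IH].
  rewrite (eq_bigr (fun=> 1)) => [|w _]; last by rewrite /path_prob big_ord0.
  by rewrite sumr_const card_tuple expn0.
pose f (u : T.-tuple (action * bool) * (action * bool)) :=
  [tuple of rcons u.1 u.2].
have fbij : bijective f.
  apply: inj_card_bij => [[u a] [v b] /(congr1 val) /= /rcons_inj[uv ab]|].
    by congr pair => //; apply: val_inj.
  by rewrite card_prod !card_tuple expnS mulnC.
rewrite (reindex f) /=; last exact: onW_bij.
rewrite -(pair_bigA _ (fun u a => path_prob p mu s0 (f (u, a)))) /=.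
rewrite -[RHS]IH; apply: eq_bigr => u _.
pose hs := run s0 u.
rewrite (eq_bigr (fun a : action * bool => path_prob p mu s0 u *
    (bernoulli_pmf (mu hs.1 hs.2) a.1 * bernoulli_pmf p a.2))); last first.
  move=> a _; rewrite /path_prob big_ord_recr /=; congr (_ * _).
    apply: eq_bigr => t _ /=.
    rewrite !(tnth_nth a) /= nth_rcons size_tuple ltn_ord.
    by rewrite -cats1 takel_cat // size_tuple ltnW.
  rewrite !(tnth_nth a) /= nth_rcons size_tuple ltnn eqxx.
  by rewrite -cats1 takel_cat ?size_tuple // take_oversize ?size_tuple.
rewrite -mulr_sumr
  -(pair_bigA _ (fun a b => bernoulli_pmf (mu hs.1 hs.2) a * bernoulli_pmf p b)).
have bern1 (q : R) : \sum_(b : bool) bernoulli_pmf q b = 1.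
  by rewrite big_bool /= addrC subrK.
under eq_bigr do rewrite -mulr_sumr bern1 mulr1.
by rewrite bern1 mulr1.
Qed.

(* Main.v *)
(* The average-cost optimality equation [g + h s = min_a (cost s a + E h s')]
   is solved explicitly. With [q = 1/p], the optimal policy uses an arrival when
   the age exceeds the threshold [m], where
     [m (m - 1) / 2 + m q <= max C 0 <= (m + 1) m / 2 + (m + 1) q],
   and updates without an arrival iff [C < 0]; [g] is the mean cost of a renewal
   cycle divided by its mean length [m + q]. The solution [h] is bounded below,
   so the greedy policy has average cost at most [g]. For an arbitrary policy,
   [g T + h s0 <= E cost + E (h (s T))], and [h] grows at most linearly in the
   age; since the age after a slot is at most the cost of that slot plus [|C|],
   [E (h (s T))] is controlled by the last increment of the expected cost, which
   cannot be linear in [T] forever unless the average cost is infinite. *)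

Require Import Defs.
From mathcomp Require Import all_boot all_order all_algebra.
From mathcomp Require Import all_classical all_reals all_analysis.
From mathcomp Require Import ring lra.

Set Implicit Arguments.
Unset Strict Implicit.
Unset Printing Implicit Defensive.

Import Order.TTheory GRing.Theory Num.Theory.
Local Open Scope ring_scope.

(** * Limits superior of running averages *)

Lemma limn_esup_le (R : realType) (u : nat -> R) (g B : R) :
  (forall n, u n <= g + n.+1%:R^-1 * B) ->
  (limn_esup (fun n => (u n)%:E) <= g%:E)%E.
Proof.
move=> uB; apply/lee_addgt0Pr => e e0.
pose N := Num.bound (`|B| / e).
apply: (@le_trans _ _ (ereal_sup [set (u n)%:E | n in [set n | (N <= n)%N]]%classic)).
  by apply: ereal_inf_lbound; exists [set n | (N <= n)%N]%classic => //; exact: nbhs_infty_ge.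
apply: ge_ereal_sup => _ [n /= Nn <-].
rewrite -EFinD lee_fin (le_trans (uB n))// lerD2l mulrC ler_pdivrMr ?ltr0n//.
have : `|B| / e < N%:R by apply: archi_boundP; rewrite divr_ge0 ?normr_ge0 ?ltW.
rewrite ltr_pdivrMr// => BN.
have Nn1 : N%:R <= n.+1%:R :> R by rewrite ler_nat ltnW.
rewrite (le_trans (ler_norm B))// (le_trans (ltW BN))// mulrC.
by rewrite ler_pM2l.
Qed.

Lemma limn_esup_ge (R : realType) (u : nat -> R) (g : R) :
  (forall N e, 0 < e -> exists2 n, (N <= n)%N & g - e <= u n) ->
  (g%:E <= limn_esup (fun n => (u n)%:E))%E.
Proof.
move=> ug; apply: le_ereal_inf_tmp => _ [V [N _ NV] <-].
apply/lee_subgt0Pr => e e0; have [n Nn un] := ug N e e0.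
rewrite (@le_trans _ _ (u n)%:E) ?lee_fin//.
by apply: ereal_sup_ubound; exists n => //; exact: NV.
Qed.

(* If [S n] stayed below [(g - e) n], the hypothesis would force the increments
   of [S] above [g] from some point on, a contradiction. *)
Lemma often_ge_of_increment (R : realType) (S : nat -> R) (g A B : R) :
  0 < A ->
  (forall n, g * n.+1%:R - B <= S n.+1 + A * (S n.+1 - S n)) ->
  forall N e, 0 < e -> exists2 n, (N <= n)%N & g - e <= n.+1%:R^-1 * S n.+1.
Proof.
move=> A0 SB N e e0; apply: contrapT => noN.
have Sub n : (N <= n)%N -> S n.+1 <= (g - e) * n.+1%:R.
  move=> Nn; rewrite leNgt; apply/negP => Sn; apply: noN; exists n => //.
  by rewrite mulrC ler_pdivlMr ?ltr0n// ltW.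
(* From index [M] on, the gap [e * n] absorbs both [B] and [A * g], so each increment of [S] is at
   least [g]. *)
pose M := Num.bound ((`|B| + A * `|g|) / e).
have Mlt : `|B| + A * `|g| < M%:R * e.
  rewrite -ltr_pdivrMr//; apply: archi_boundP.
  by rewrite divr_ge0 ?(ltW e0)// addr_ge0 ?mulr_ge0// ltW.
pose n0 := maxn N M.
have step n : (n0 <= n)%N -> S n + g <= S n.+1.
  rewrite geq_max => /andP[Nn Mn].
  have Mn1 : M%:R * e <= n.+1%:R * e by rewrite ler_pM2r// ler_nat ltnW.
  have H1 := Sub n Nn; have H2 := SB n.
  have H3 : A * g <= A * `|g| by rewrite ler_pM2l// ler_norm.
  have H4 := ler_norm B.
  have : A * g <= A * (S n.+1 - S n) by nra.
  by rewrite ler_pM2l//; lra.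
have Slb k : S n0 + g * k%:R <= S (n0 + k)%N.
  elim: k => [|k IH]; first by rewrite mulr0 addr0 addn0.
  rewrite addnS (le_trans _ (step _ (leq_addr _ _)))//.
  by rewrite -addn1 natrD; lra.
(* Growth at rate [g] from [n0], against the ceiling of slope [g - e], would give
   [e * k.+1 <= (g - e) * n0 - S n0], which fails once [k] exceeds [c]. *)
pose c := `|(g - e) * n0%:R - S n0| / e.
pose k := Num.bound c.
have : c < k%:R by apply: archi_boundP; rewrite divr_ge0 ?normr_ge0// ltW.
rewrite /c ltr_pdivrMr// => ck.
have H1 := Slb k.+1; have H2 : S (n0 + k).+1 <= _ := Sub _ (leq_trans (leq_maxl N M) (leq_addr k n0)).
have H3 := ler_norm ((g - e) * n0%:R - S n0).
move: H1 H2; rewrite addnS -addn1 -[(n0 + k).+1]addn1 !natrD; nra.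
Qed.

(** * Sums over trajectories and their one-step expansion *)

Lemma run_rcons (s0 : state) (w : seq (action * bool)) (a : action * bool) :
  run s0 (rcons w a) = (rcons (run s0 w).1 ((run s0 w).2, a.1),
                        next_state (run s0 w).2 a.1 a.2).
Proof. by rewrite /run foldl_rcons. Qed.

Section Trajectories.
Variables (R : realType) (p C : R) (mu : policy R) (s0 : state).

Lemma path_prob_rcons (T : nat) (w : T.-tuple (action * bool)) (a : action * bool) :
  path_prob p mu s0 [tuple of rcons w a] =
  path_prob p mu s0 w *
    (bernoulli_pmf (mu (run s0 w).1 (run s0 w).2) a.1 * bernoulli_pmf p a.2).
Proof.
rewrite /path_prob big_ord_recr /=; congr (_ * _).
  apply: eq_bigr => t _ /=.
  rewrite !(tnth_nth a) /= nth_rcons size_tuple ltn_ord.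
  by rewrite -cats1 takel_cat // size_tuple ltnW.
rewrite !(tnth_nth a) /= nth_rcons size_tuple ltnn eqxx.
by rewrite -cats1 takel_cat ?size_tuple // take_oversize ?size_tuple.
Qed.

Lemma path_cost_rcons (T : nat) (w : T.-tuple (action * bool)) (a : action * bool) :
  path_cost C s0 [tuple of rcons w a] =
  path_cost C s0 w + cost C (run s0 w).2 a.1.
Proof.
rewrite /path_cost big_ord_recr /=; congr (_ + _).
  apply: eq_bigr => t _ /=.
  rewrite !(tnth_nth a) /= nth_rcons size_tuple ltn_ord.
  by rewrite -cats1 takel_cat // size_tuple ltnW.
rewrite !(tnth_nth a) /= nth_rcons size_tuple ltnn eqxx.
by rewrite -cats1 takel_cat ?size_tuple // take_oversize ?size_tuple.
Qed.

Lemma big_tuple_rcons (T : nat) (F : T.+1.-tuple (action * bool) -> R) :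
  \sum_w F w = \sum_(w : T.-tuple (action * bool)) \sum_a F [tuple of rcons w a].
Proof.
pose f (u : T.-tuple (action * bool) * (action * bool)) :=
  [tuple of rcons u.1 u.2].
have fbij : bijective f.
  apply: inj_card_bij => [[u a] [v b] /(congr1 val) /= /rcons_inj[uv ab]|].
    by congr pair => //; apply: val_inj.
  by rewrite card_prod !card_tuple expnS mulnC.
rewrite (reindex f) /=; last exact: onW_bij.
by rewrite -(pair_bigA _ (fun u a => F (f (u, a)))).
Qed.

Definition expected_value (h : state -> R) (T : nat) : R :=
  \sum_(w : T.-tuple (action * bool)) path_prob p mu s0 w * h (run s0 w).2.

Definition action_value (h : state -> R) (s : state) (a : action) : R :=
  cost C s a + \sum_b bernoulli_pmf p b * h (next_state s a b).

Lemma sum_bernoulli_pmf (q : R) : \sum_(b : bool) bernoulli_pmf q b = 1.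
Proof. by rewrite big_bool /= addrC subrK. Qed.

(** Conditioning on the first [T] slots: the cost of the last slot and the terminal value [h] merge
    into [action_value], averaged over the randomized action. *)
Lemma expected_costS (h : state -> R) (T : nat) :
  expected_cost p C mu s0 T.+1 + expected_value h T.+1 =
  expected_cost p C mu s0 T +
  \sum_(w : T.-tuple (action * bool)) path_prob p mu s0 w *
    \sum_a bernoulli_pmf (mu (run s0 w).1 (run s0 w).2) a *
      action_value h (run s0 w).2 a.
Proof.
rewrite /expected_cost /expected_value !big_tuple_rcons -!big_split /=.
apply: eq_bigr => w _.
under eq_bigr do rewrite path_prob_rcons path_cost_rcons.
under [X in _ + X]eq_bigr do rewrite path_prob_rcons run_rcons /=.
rewrite -mulrDr.
set P := path_prob p mu s0 w; set K := path_cost C s0 w.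
set q := mu _ _; set s := (run s0 w).2.
rewrite -(pair_bigA _ (fun a b => P * (bernoulli_pmf q a * bernoulli_pmf p b) *
  (K + cost C s a))).
rewrite -(pair_bigA _ (fun a b => P * (bernoulli_pmf q a * bernoulli_pmf p b) *
  h (next_state s a b))) /=.
rewrite !big_bool /action_value !big_bool /bernoulli_pmf /=; ring.
Qed.

Hypothesis p01 : 0 <= p <= 1.

Lemma expected_value_le (f h : state -> R) (T : nat) :
  (forall s, f s <= h s) -> expected_value f T <= expected_value h T.
Proof.
by move=> fh; apply: ler_sum => w _; rewrite ler_wpM2l ?path_prob_ge0.
Qed.

Lemma expected_value_affine (a b : R) (h : state -> R) (T : nat) :
  expected_value (fun s => a * h s + b) T = a * expected_value h T + b.
Proof.
rewrite -[b in RHS]mulr1 -(sum_path_prob p mu s0 T) !mulr_sumr -big_split /=.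
by apply: eq_bigr => w _; ring.
Qed.

Lemma expected_value0 (h : state -> R) : expected_value h 0 = h s0.
Proof.
rewrite /expected_value (big_pred1 [tuple]) => [|w].
  by rewrite /path_prob big_ord0 mul1r.
by rewrite [w]tuple0; apply/esym/eqP.
Qed.

Lemma expected_cost0 : expected_cost p C mu s0 0 = 0.
Proof.
by rewrite /expected_cost big1// => w _; rewrite /path_cost big_ord0 mulr0.
Qed.

Lemma le_sum_action_value (g : R) (h : state -> R) :
  (forall s a, g + h s <= action_value h s a) ->
  forall hs s, g + h s <= \sum_a bernoulli_pmf (mu hs s) a * action_value h s a.
Proof.
move=> gh hs s; rewrite -[leLHS]mul1r -(sum_bernoulli_pmf (mu hs s)) mulr_suml.
by apply: ler_sum => a _; rewrite ler_wpM2l ?bernoulli_pmf_ge0 ?update_prob_itv.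
Qed.

(** The one-step inequality, averaged over trajectories, telescopes in [T]. *)
Lemma expected_cost_ge (g : R) (h : state -> R) (T : nat) :
  (forall hs s, g + h s <=
     \sum_a bernoulli_pmf (mu hs s) a * action_value h s a) ->
  g * T%:R + h s0 <= expected_cost p C mu s0 T + expected_value h T.
Proof.
move=> gh; elim: T => [|T IH].
  by rewrite mulr0 expected_value0 expected_cost0.
have step : g + expected_value h T <=
  \sum_(w : T.-tuple (action * bool)) path_prob p mu s0 w *
    \sum_a bernoulli_pmf (mu (run s0 w).1 (run s0 w).2) a *
      action_value h (run s0 w).2 a.
  rewrite -[expected_value h T]mul1r addrC -expected_value_affine.
  by apply: ler_sum => w _; rewrite ler_wpM2l ?path_prob_ge0// mul1r addrC.
by rewrite expected_costS -[T.+1%:R]natr1; lra.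
Qed.

Lemma expected_cost_eq (g : R) (h : state -> R) (T : nat) :
  (forall hs s, g + h s =
     \sum_a bernoulli_pmf (mu hs s) a * action_value h s a) ->
  expected_cost p C mu s0 T + expected_value h T = g * T%:R + h s0.
Proof.
move=> gh; elim: T => [|T IH].
  by rewrite mulr0 expected_value0 expected_cost0.
have step : \sum_(w : T.-tuple (action * bool)) path_prob p mu s0 w *
    \sum_a bernoulli_pmf (mu (run s0 w).1 (run s0 w).2) a *
      action_value h (run s0 w).2 a = g + expected_value h T.
  rewrite -[expected_value h T]mul1r [RHS]addrC -expected_value_affine.
  by apply: eq_bigr => w _; rewrite -gh mul1r addrC.
by rewrite expected_costS step -[T.+1%:R]natr1; lra.
Qed.

(** The cost minus the next age is exactly [C * a], whether or not the age is reset. *)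
Lemma next_age_le_cost (s : state) (a : action) :
  (sval (next_age s.1 s.2 a))%:R - `|C| <= cost C s a.
Proof.
case: s => x lam; rewrite /next_age /cost /=.
have := ler_norm (- C); have := normr_ge0 C; rewrite normrN.
by move: (`|C|) => N N0 CN; case: a; case: lam; rewrite /= ?mulr1n ?mulr0n ?mulr1 ?mulr0 -?natr1; lra.
Qed.

Lemma expected_age_le (T : nat) :
  expected_value (fun s => (sval s.1)%:R) T.+1 <=
  expected_cost p C mu s0 T.+1 - expected_cost p C mu s0 T + `|C|.
Proof.
(* With minus the age as terminal value, [action_value] is the cost minus the next age, hence at
   least [- |C|]. *)
have := expected_costS (fun s => - (sval s.1)%:R) T.
set E := \sum_w _ => eqE.
have EC : - `|C| <= E.
  rewrite -[leLHS]mul1r -(sum_path_prob p mu s0 T) mulr_suml.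
  apply: ler_sum => w _; rewrite ler_wpM2l ?path_prob_ge0//.
  rewrite -[leLHS]mul1r.
  rewrite -[X in X * _ <= _](sum_bernoulli_pmf (mu (run s0 w).1 (run s0 w).2)).
  rewrite mulr_suml; apply: ler_sum => a _.
  rewrite ler_wpM2l ?bernoulli_pmf_ge0 ?update_prob_itv//.
  rewrite /action_value /= -mulr_suml sum_bernoulli_pmf mul1r.
  by rewrite lerBrDl; exact: next_age_le_cost.
have eqN : expected_value (fun s => - (sval s.1)%:R) T.+1 =
           - expected_value (fun s => (sval s.1)%:R) T.+1.
  by rewrite /expected_value -sumrN; apply: eq_bigr => w _; rewrite mulrN.
by move: eqE; rewrite eqN; lra.
Qed.

End Trajectories.

(** * From the optimality equation to bounds on the average cost *)

Lemma average_cost_ge (R : realType) (p C g A B : R) (h : state -> R)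
    (mu : policy R) (s0 : state) :
  0 <= p <= 1 -> 0 < A -> (forall s a, g + h s <= action_value p C h s a) ->
  (forall s, h s <= A * (sval s.1)%:R + B) ->
  (g%:E <= average_cost p C mu s0)%E.
Proof.
move=> p01 A0 gh hA; apply: limn_esup_ge.
(* The terminal term is at most [A] times the expected age plus [B], and the expected age is at most
   the last cost increment plus [|C|]. *)
apply: (@often_ge_of_increment _ (expected_cost p C mu s0) g A
  (A * `|C| + B - h s0)) => // n.
have H1 := @expected_cost_ge _ p C mu s0 p01 g h n.+1
  (@le_sum_action_value _ p C mu g h gh).
have H2 := @expected_value_le _ p mu s0 p01 _ _ n.+1 hA.
rewrite expected_value_affine in H2.
have := expected_age_le C mu s0 p01 n; rewrite -(ler_pM2l A0).
lra.
Qed.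

Lemma average_cost_le (R : realType) (p C g B : R) (h : state -> R)
    (mu : policy R) (s0 : state) :
  0 <= p <= 1 -> (forall hs s, g + h s =
    \sum_a bernoulli_pmf (mu hs s) a * action_value p C h s a) ->
  (forall s, B <= h s) -> (average_cost p C mu s0 <= g%:E)%E.
Proof.
move=> p01 gh Bh; apply: (@limn_esup_le _ _ _ (h s0 - B)) => n.
have H1 := @expected_cost_eq _ p C mu s0 g h n.+1 gh.
have H2 : B <= expected_value p mu s0 h n.+1.
  (* The constant [B] is viewed as the affine function [0 * h + B] of the state. *)
  rewrite -[B]add0r -[in leLHS](mul0r (expected_value p mu s0 h n.+1)).
  rewrite -expected_value_affine; apply: expected_value_le => // s.
  by rewrite mul0r add0r.
have n0 : 0 < n.+1%:R :> R by rewrite ltr0n.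
rewrite -(ler_pM2l n0) mulrDr !mulVKf ?gt_eqF//; lra.
Qed.

(** * Explicit solution of the optimality equation *)

Lemma exists_threshold (R : realType) (q D : R) : 1 <= q -> 0 <= D ->
  exists m : nat, m%:R * (m%:R - 1) / 2 + m%:R * q <= D /\
    D <= (m%:R + 1) * m%:R / 2 + (m%:R + 1) * q.
Proof.
move=> q1 D0.
pose P m := D <= (m%:R + 1) * m%:R / 2 + (m%:R + 1) * q.
have exP : exists m, P m.
  exists (Num.bound D); have := archi_boundP D0; rewrite /P.
  by have : 0 <= (Num.bound D)%:R :> R by []; nra.
have [m Pm minm] := ex_minnP exP; exists m; split => //.
case: m Pm minm => [_ _|m Pm minm]; first by rewrite !mul0r addr0.
(* The upper bound at the preceding index is the required lower bound, so minimality supplies it. *)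
have : ~~ P m by apply/negP => /minm; rewrite ltnn.
by rewrite /P -ltNge -natr1; lra.
Qed.

(* With the age shifted by one, [rel_value g q m y] is the relative value of
   age [y.+1], averaged over the arrival indicator and normalized to [0] at age
   [1], when arrivals are used exactly at the ages exceeding [m]. *)
Fixpoint rel_value (R : realType) (g q : R) (m y : nat) : R :=
  if y is z.+1 then
    rel_value g q m z + (if (z < m)%N then g - z%:R - 2 else q - 1)
  else 0.

Lemma rel_valueS (R : realType) (g q : R) (m y : nat) :
  rel_value g q m y.+1 =
  rel_value g q m y + (if (y < m)%N then g - y%:R - 2 else q - 1).
Proof. by []. Qed.

Arguments rel_value : simpl never.

Section Bellman.
Variables (R : realType) (p q C g : R) (m : nat).
Local Notation c := (Num.min C 0).
Local Notation W := (rel_value g q m).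
Hypotheses (pq : p * q = 1) (q_ge1 : 1 <= q).
Hypothesis threshold : 0 <= C ->
  m%:R * (m%:R - 1) / 2 + m%:R * q <= C /\
  C <= (m%:R + 1) * m%:R / 2 + (m%:R + 1) * q.
Hypothesis threshold0 : C < 0 -> m = 0%N.
(** A cycle idles at ages [1] to [m], costing [m (m + 3) / 2], then waits a geometric time of mean
    [q] for an arrival. The [q - 1] expected slots without arrival there each add [c], and the final
    update adds [C]. No [c] is charged at ages up to [m], since [C < 0] forces [m = 0]. *)
Hypothesis gE : g * (m%:R + q) =
  m%:R * (m%:R + 3) / 2 + (q - 1) * m%:R + q ^+ 2 + C + (q - 1) * c.

(** Under the lower threshold bound on [C], the right-hand side of [gE] is at least
    [(m + q) ^ 2]. *)
Lemma gain_ge : (0 < m)%N -> m%:R + q <= g.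
Proof.
move=> m0; have C0 : 0 <= C by case: leP => // /threshold0 m00; rewrite m00 in m0.
have [Cm _] := threshold C0; have c0 : c = 0 by rewrite min_r.
have mq0 : 0 < m%:R + q by rewrite ltr_wpDl// (lt_le_trans _ q_ge1).
by rewrite -(ler_pM2r mq0) gE c0; lra.
Qed.

Lemma rel_valueE_le (y : nat) : (y <= m)%N ->
  W y = y%:R * g - y%:R * (y%:R + 3) / 2.
Proof.
elim: y => [_|y IH ym]; first by rewrite /rel_value; lra.
by rewrite rel_valueS ym IH 1?ltnW// -natr1; lra.
Qed.

(** Below [m] the increment is at least [g - m - 1], which [gain_ge] bounds below by [q - 1]. *)
Lemma rel_value_leS (y : nat) : W y <= W y.+1.
Proof.
have q1 := q_ge1.
rewrite rel_valueS lerDl; case: ifP => ym; last by rewrite subr_ge0.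
have := gain_ge (leq_ltn_trans (leq0n y) ym).
have : y.+1%:R <= m%:R :> R by rewrite ler_nat.
by rewrite -natr1; lra.
Qed.

Lemma rel_value_homo (y z : nat) : (y <= z)%N -> W y <= W z.
Proof.
exact: (homo_leq (r := fun x y : R => x <= y) _ le_trans rel_value_leS).
Qed.

Lemma rel_value_ge0 (y : nat) : 0 <= W y.
Proof. by have := rel_value_homo (leq0n y). Qed.

Lemma rel_value_le (y : nat) : W y <= (`|g| + q) * y%:R.
Proof.
have q1 := q_ge1.
elim: y => [|y IH]; first by rewrite mulr0.
apply: (@le_trans _ _ (W y + (`|g| + q))); last by rewrite -natr1 mulrDr mulr1 lerD2r.
have := ler_norm g; have := normr_ge0 g; have : 0 <= y%:R :> R by [].
by rewrite lerD2l; case: ifP => _; lra.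
Qed.

(** The right-hand side is the expected cost of the rest of a cycle from age [m + 1], minus [g]
    times its mean length [q]; [gE] makes it agree with the recursion from age [1]. *)
Lemma rel_value_threshold :
  W m = (q - 1) * (m%:R + 1 + q + c) + 1 + C - q * g.
Proof.
have gE' := gE. (* [lra] ignores section hypotheses *)
by rewrite rel_valueE_le//; lra.
Qed.

(** By monotonicity it suffices to take [x = m], where the claim amounts to
    [q * (m + q) <= q * g]. *)
Lemma idle_le_update (x : nat) : (0 < x <= m)%N -> x%:R + W x <= C.
Proof.
have q1 := q_ge1.
move=> /andP[x0 xm].
have m0 := leq_trans x0 xm; have gm := gain_ge m0.
have C0 : 0 <= C by case: leP => // /threshold0 m00; rewrite m00 in m0.
have c0 : c = 0 by rewrite min_r.
have : x%:R + W x <= m%:R + W m by rewrite lerD ?ler_nat// rel_value_homo.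
by rewrite rel_value_threshold c0; nra.
Qed.

(** By monotonicity it suffices to take [x = m + 1]. For [C >= 0] this amounts to [g <= m + q + 1],
    which is the upper threshold bound inserted in [gE]. *)
Lemma update_le_idle (x : nat) : (m < x)%N -> C <= x%:R + W x.
Proof.
have q1 := q_ge1.
move=> mx.
have : m.+1%:R + W m.+1 <= x%:R + W x by rewrite lerD ?ler_nat// rel_value_homo.
rewrite rel_valueS ltnn -natr1.
have [C0|C0] := leP 0 C; last by have := rel_value_ge0 m; have : 0 <= m%:R :> R by []; lra.
have [_ Cm] := threshold C0; have c0 : c = 0 by rewrite min_r.
have mq0 : 0 < m%:R + q by rewrite ltr_wpDl// (lt_le_trans _ q_ge1).
have : g <= m%:R + q + 1 by rewrite -(ler_pM2r mq0) gE c0; lra.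
by rewrite rel_value_threshold c0; nra.
Qed.

(** Each branch is the cost of the greedy action plus [W] at the next age, minus [g]; after an
    update with arrival the latter is [W 0 = 0]. *)
Definition bias (s : state) : R :=
  let x := sval s.1 in
  (if s.2 then if (x <= m)%N then x%:R + 1 + W x else 1 + C
   else x%:R + 1 + c + W x) - g.

Lemma rel_value_ge_threshold (y : nat) : (m <= y)%N ->
  W y = W m + (q - 1) * (y%:R - m%:R).
Proof.
elim: y => [|y IH]; first by rewrite leqn0 => /eqP ->; lra.
rewrite leq_eqVlt => /predU1P[->|]; first by lra.
by rewrite ltnS => my; rewrite rel_valueS ltnNge my IH//= -natr1; lra.
Qed.

Lemma mean_bias (x : age) :
  \sum_b bernoulli_pmf p b * bias (x, b) = W (sval x).-1.
Proof.
rewrite big_bool /bernoulli_pmf /bias /=.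
case: x => -[//|y] _ /=; rewrite -natr1.
case: (ltnP y m) => ym.
  (* Below the threshold [C] is nonnegative, so the bias does not depend on the arrival
     indicator. *)
  have c0 : c = 0.
    rewrite min_r// leNgt; apply/negP => /threshold0 m0; by rewrite m0 in ym.
  by rewrite c0 rel_valueS ym; ring.
have qp : q * p = 1 by rewrite mulrC.
have q0 : q != 0 by rewrite gt_eqF// (lt_le_trans _ q_ge1).
(* Multiplying by [q] clears [p], leaving weights [1] and [q - 1]; the rest is
   [rel_value_threshold]. *)
apply: (mulfI q0).
rewrite rel_valueS ltnNge ym /= (rel_value_ge_threshold ym).
have := rel_value_threshold; set w := W m; set Y := y%:R; set M := m%:R => wE.
rewrite (_ : q * _ = (q * p) * (1 + C - g) + (q - q * p) *
  (Y + 1 + 1 + c + (w + (q - 1) * (Y - M) + (q - 1)) - g)); last by ring.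
by rewrite qp; lra.
Qed.

Lemma action_valueE (x : age) (lam : bool) (a : action) :
  action_value p C bias (x, lam) a =
  if a && lam then 1 + C else (sval x)%:R + 1 + C * a%:R + W (sval x).
Proof.
rewrite /action_value /next_state mean_bias /cost /next_age /=.
have W0 : W 0 = 0 by [].
by case: a; case: lam; rewrite /= ?W0 ?mulr1n ?mulr0n; lra.
Qed.

Lemma bias_le_action_value (s : state) (a : action) :
  g + bias s <= action_value p C bias s a.
Proof.
case: s => x lam; rewrite action_valueE /bias /= [g + _]addrC subrK.
have cC : c <= C by rewrite ge_min lexx.
have c0 : c <= 0 by rewrite ge_min lexx orbT.
case: lam; rewrite ?andbF ?andbT; last by case: a; rewrite /= ?mulr1n ?mulr0n; lra.
case: ifP => xm.
  have : (0 < sval x <= m)%N by rewrite xm (valP x).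
  move=> /idle_le_update.
  by case: a; rewrite /= ?mulr0n; lra.
have : (m < sval x)%N by rewrite ltnNge xm.
move=> /update_le_idle.
by case: a; rewrite /= ?mulr0n; lra.
Qed.

Definition greedy (s : state) : action :=
  if s.2 then (m < sval s.1)%N else C < 0.

Lemma bias_greedy (s : state) :
  g + bias s = action_value p C bias s (greedy s).
Proof.
case: s => x lam; rewrite action_valueE /bias /greedy /= [g + _]addrC subrK.
case: lam; rewrite ?andbF ?andbT.
  by rewrite ltnNge; case: ifP => xm //=; rewrite mulr0n; lra.
by case: ltP => C0; rewrite /= ?mulr0n ?mulr1n; lra.
Qed.

Lemma bias_ge (s : state) : - `|C| - `|g| <= bias s.
Proof.
case: s => x lam; rewrite /bias /=; set X := (sval x)%:R.
have X0 : 0 <= X by [].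
have W0 := rel_value_ge0 (sval x).
have Cc : - `|C| <= c by rewrite le_min oppr_le0 normr_ge0 lerNl -normrN ler_norm.
have CC : - `|C| <= C by rewrite lerNl -normrN ler_norm.
have gg := ler_norm g; have C0 := normr_ge0 C.
by case: lam; [case: ifP => _|]; lra.
Qed.

Lemma bias_le (s : state) :
  bias s <= (1 + `|g| + q) * (sval s.1)%:R + (1 + `|C| + `|g|).
Proof.
have q1 := q_ge1.
case: s => x lam; rewrite /bias /=.
have := rel_value_le (sval x); set X := (sval x)%:R => WX.
have X0 : 0 <= X by [].
have c0 : c <= 0 by rewrite ge_min lexx orbT.
have CC := ler_norm C; have C0 := normr_ge0 C.
have gg : - g <= `|g| by rewrite -normrN ler_norm.
have gX : 0 <= (`|g| + q) * X by rewrite mulr_ge0// addr_ge0// (le_trans _ q_ge1).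
by case: lam; [case: ifP => _|]; lra.
Qed.

End Bellman.

Theorem theorem2 (R : realType) (p C : R) (hp0 : 0 < p) (hp1 : p <= 1) :
  exists mu : policy R,
    [/\ stationary mu, deterministic mu
      & forall s0 : state, cost_optimal p C s0 mu].
Proof.
have q1 : 1 <= p^-1 by rewrite invf_ge1.
have D0 : 0 <= Num.max C 0 by rewrite le_max lexx orbT.
have [m [mD Dm]] := exists_threshold q1 D0.
have m_ge0 : 0 <= m%:R :> R by [].
have thr : 0 <= C -> m%:R * (m%:R - 1) / 2 + m%:R * p^-1 <= C /\
    C <= (m%:R + 1) * m%:R / 2 + (m%:R + 1) * p^-1.
  by move=> C0; rewrite max_l in mD Dm.
have thr0 : C < 0 -> m = 0%N.
  move=> C0; move: mD; rewrite max_r; last exact: ltW.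
  (* Here [max C 0 = 0], and the lower threshold expression is positive for every [m > 0]. *)
  case: m {Dm thr} m_ge0 => // m _; rewrite -natr1 => mD.
  by exfalso; have : 0 <= m%:R :> R by []; nra.
have mq : m%:R + p^-1 != 0 by rewrite gt_eqF// ltr_wpDl// invr_gt0.
set q := p^-1 in thr mq q1 *.
have [g gE] : exists g : R, g * (m%:R + q) = m%:R * (m%:R + 3) / 2 +
    (q - 1) * m%:R + q ^+ 2 + C + (q - 1) * Num.min C 0.
  by eexists; exact: (divfK mq).
have pq : p * q = 1 by rewrite mulfV// gt_eqF.
have p01 : 0 <= p <= 1 by rewrite hp1 ltW.
pose u (h : history) (s : state) : R := (greedy C m s)%:R.
have u01 h s : 0 <= u h s <= 1 by rewrite /u; case: greedy; rewrite lexx ler01.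
exists (Policy u01); split => //.
  by move=> h s; rewrite /= /u; case: greedy; [right|left].
(* The constant [g] separates the two average costs, whatever the initial state. *)
move=> s0 nu; apply: (@le_trans _ _ g%:E).
  apply: (average_cost_le s0 p01 (h := bias q C g m));
    last exact: (bias_ge q1 thr thr0 gE).
  move=> hs s; rewrite (bias_greedy pq q1 thr0 gE) big_bool /bernoulli_pmf /= /u.
  by case: greedy; rewrite /= ?mulr1n ?mulr0n; ring.
apply: (average_cost_ge nu s0 p01 (A := 1 + `|g| + q) (h := bias q C g m)) => //.
- by have := normr_ge0 g; lra.
- exact: (bias_le_action_value pq q1 thr thr0 gE).
- by move=> s; exact: bias_le.
Qed.
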